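(* Let $R$ be any one of the following eight subsets of $\{0,1,2,3\}^2$: (A17) $\{(0,0),(0,1),(0,2),(0,3),(1,1),(2,1),(3,1),(3,2)\}$; (A18) $\{(0,0),(0,1),(0,2),(0,3),(1,2),(2,2),(3,2),(3,1)\}$; (A19) $\{(0,0),(1,0),(2,0),(3,0),(1,1),(1,2),(1,3),(2,3)\}$; (A20) $\{(0,0),(1,0),(2,0),(3,0),(2,1),(2,2),(2,3),(1,3)\}$; (A21) $\{(0,1),(0,2),(1,1),(2,1),(3,1),(3,0),(3,2),(3,3)\}$; (A22) $\{(0,1),(0,2),(1,2),(2,2),(3,2),(3,1),(3,0),(3,3)\}$; (A23) $\{(0,3),(1,3),(2,3),(3,3),(1,0),(2,0),(2,1),(2,2)\}$; (A24) $\{(0,3),(1,3),(2,3),(3,3),(1,0),(2,0),(1,1),(1,2)\}$. Let $q_1=(123,R)$ and $q_2=(321,R)$. Then $q_1$ and $q_2$ are jointly equidistributed. Moreover, for $n\ge 2$ and integers $k,\ell\ge 0$, letting $T_{n,k,\ell}$ be the number of $\pi\in S_n$ with exactly $k$ occurrences of $q_1$ and exactly $\ell$ occurrences of $q_2$, we have \[ T_{n,k,\ell}=\begin{cases} \binom{k+\ell+2}{k+1}c(n-1,k+\ell+2), & k\ge1,\ \ell\ge1,\\ (k+2)c(n-1,k+2)+c(n-1,k+1), & k\ge 1,\ \ell=0,\\ (\ell+2)c(n-1,\ell+2)+c(n-1,\ell+1), & \ell\ge1,\ k=0,\\ 2(n-2)!\left(1+\sum_{i=1}^{n-2}\frac1i\right),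 & k=\ell=0. \end{cases} \] Equivalently, \[ \sum_{k=0}^{n-2}\sum_{\ell=0}^{n-2}T_{n,k,\ell}x^ky^\ell=\sum_{i=0}^{n-2}c(n-1,i+1)(x^i+y^i)+\sum_{k=0}^{n-2}\sum_{\ell=0}^{n-2}\binom{k+\ell+2}{k+1}c(n-1,k+\ell+2)x^ky^\ell . \]
   Context: $S_n$ is the set of permutations of $\{1,\dots,n\}$. A mesh pattern of length $k$ is a pair $(\tau,R)$ with $\tau\in S_k$ and $R\subseteq\{0,\dots,k\}^2$; the element $(a,b)\in R$ is the ''shaded box'' whose corners are $(a,b),(a,b+1),(a+1,b+1),(a+1,b)$ in the plot of $\tau$ (first coordinate = position, second = value). An occurrence of $(\tau,R)$ in $\pi=\pi_1\cdots\pi_n\in S_n$ is a tuple of indices $i_1<\dots<i_k$ such that $\pi_{i_1}\cdots\pi_{i_k}$ is order-isomorphic to $\tau$ and, setting $i_0=0$, $i_{k+1}=n+1$, letting $v_1<\dots<v_k$ be the values $\pi_{i_1},\dots,\pi_{i_k}$ in increasing order and $v_0=0$, $v_{k+1}=n+1$, for every $(a,b)\in R$ there is no index $m$ with $i_a<m<i_{a+1}$ and $v_b<\pi_m<v_{b+1}$. The number of occurrences is the number of such index tuples. Two mesh patterns $q_1,q_2$ are jointly equidistributed if for all $n\ge 1$ and all integers $k,\ell\ge 0$, the number of $\pi\in S_n$ with exactly $k$ occurrences of $q_1$ and exactly $\ell$ occurrences of $q_2$ equals the number with exactly $\ell$ occurrences of $q_1$ and exactly $k$ occurrences of $q_2$.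 $c(n,k)$ denotes the unsigned Stirling numbers of the first kind: $c(0,0)=1$, $c(n,k)=0$ if $n<k$ or if $k=0<n$, and $c(n,k)=(n-1)c(n-1,k)+c(n-1,k-1)$. *)

(* Defs.v *)
From mathcomp Require Import all_boot all_order all_fingroup all_algebra.

Set Implicit Arguments.
Unset Strict Implicit.
Unset Printing Implicit Defensive.

(* Permutations of {1, ..., n} are elements of 'S_n = {perm 'I_n}: position and
   value i of the 1-based convention correspond to the ordinal i - 1, so .+1
   below converts ordinals back to 1-based positions and values. *)

Definition mesh_pattern (k : nat) : Type :=
  ('S_k * {set 'I_k.+1 * 'I_k.+1})%type.

(* The a-th term of s_0 = 0, s_1, ..., s_k, s_(k+1) = n + 1, where
   s = [:: s_1; ...; s_k]. *)
Definition grid_line (n : nat) (s : seq nat) (a : nat) : nat :=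
  nth 0 (0 :: rcons s n.+1) a.

Definition occ_positions (n k : nat) (f : {ffun 'I_k -> 'I_n}) : seq nat :=
  [seq (f j).+1 | j <- enum 'I_k].

Definition occ_values (n k : nat) (pi : 'S_n) (f : {ffun 'I_k -> 'I_n}) :
    seq nat :=
  sort leq [seq (pi (f j)).+1 | j <- enum 'I_k].

Definition order_isomorphic (n k : nat) (tau : 'S_k) (pi : 'S_n)
    (f : {ffun 'I_k -> 'I_n}) : bool :=
  [forall a : 'I_k, forall b : 'I_k,
    (pi (f a) < pi (f b)) == (tau a < tau b)].

Definition box_empty (n k : nat) (pi : 'S_n) (f : {ffun 'I_k -> 'I_n})
    (a b : nat) : bool :=
  let i := grid_line n (occ_positions f) in
  let v := grid_line n (occ_values pi f) in
  ~~ [exists m : 'I_n, (i a < m.+1 < i a.+1) && (v b < (pi m).+1 < v b.+1)].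

Definition occurrence (n k : nat) (q : mesh_pattern k) (pi : 'S_n)
    (f : {ffun 'I_k -> 'I_n}) : bool :=
  [&& [forall a : 'I_k, forall b : 'I_k, (a < b) ==> (f a < f b)],
      order_isomorphic q.1 pi f
    & [forall c in q.2, box_empty pi f c.1 c.2]].

Definition occurrences (n k : nat) (q : mesh_pattern k) (pi : 'S_n) : nat :=
  #|[set f : {ffun 'I_k -> 'I_n} | occurrence q pi f]|.

Definition joint_count (k1 k2 : nat) (q1 : mesh_pattern k1)
    (q2 : mesh_pattern k2) (n k l : nat) : nat :=
  #|[set pi : 'S_n | (occurrences q1 pi == k) && (occurrences q2 pi == l)]|.

Definition jointly_equidistributed (k1 k2 : nat) (q1 : mesh_pattern k1)
    (q2 : mesh_pattern k2) : Prop :=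
  forall n k l : nat, 1 <= n ->
    joint_count q1 q2 n k l = joint_count q1 q2 n l k.

Fixpoint stirling1 (n k : nat) : nat :=
  match n, k with
  | 0, 0 => 1
  | 0, _.+1 => 0
  | _.+1, 0 => 0
  | n'.+1, k'.+1 => n' * stirling1 n' k + stirling1 n' k'
  end.

Definition perm123 : 'S_3 := 1%g.
Definition perm321 : 'S_3 := perm (@rev_ord_inj 3).

Definition boxes (s : seq (nat * nat)) : {set 'I_4 * 'I_4} :=
  [set c : 'I_4 * 'I_4 | (val c.1, val c.2) \in s].

Definition A17 := boxes
  [:: (0, 0); (0, 1); (0, 2); (0, 3); (1, 1); (2, 1); (3, 1); (3, 2)].
Definition A18 := boxes
  [:: (0, 0); (0, 1); (0, 2); (0, 3); (1, 2); (2, 2); (3, 2); (3, 1)].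
Definition A19 := boxes
  [:: (0, 0); (1, 0); (2, 0); (3, 0); (1, 1); (1, 2); (1, 3); (2, 3)].
Definition A20 := boxes
  [:: (0, 0); (1, 0); (2, 0); (3, 0); (2, 1); (2, 2); (2, 3); (1, 3)].
Definition A21 := boxes
  [:: (0, 1); (0, 2); (1, 1); (2, 1); (3, 1); (3, 0); (3, 2); (3, 3)].
Definition A22 := boxes
  [:: (0, 1); (0, 2); (1, 2); (2, 2); (3, 2); (3, 1); (3, 0); (3, 3)].
Definition A23 := boxes
  [:: (0, 3); (1, 3); (2, 3); (3, 3); (1, 0); (2, 0); (2, 1); (2, 2)].
Definition A24 := boxes
  [:: (0, 3); (1, 3); (2, 3); (3, 3); (1, 0); (2, 0); (1, 1); (1, 2)].

(* Main.v *)
(* Write pi = u 1 w, the word split at its smallest letter. For the shading A19,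
   an occurrence of 123 is: the letter 1, the first letter of w, and a later
   left-to-right maximum of w; an occurrence of 321 is: a right-to-left maximum
   of u other than its last letter, the letter following it, and 1. So the two
   numbers of occurrences are lrmax(w) - 1 and rlmax(u) - 1 (0 on empty words).
   Inserting a new second smallest letter changes rlmax(u) or lrmax(w) only when
   it lands just before or just after 1, which gives the Stirling recurrence
   combined with Pascal's rule: the pair (rlmax(u), lrmax(w)) takes the value
   (i, j) on 'C(i + j, i) c(n - 1, i + j) permutations. Inversion keeps 123 and
   321 fixed and complement exchanges them, so the other seven shadings reduce
   to A19 and to the symmetry in (k, l). *)
Require Import Defs.
From mathcomp Require Import all_boot all_order all_fingroup all_algebra.
From mathcomp Require Import zify ring.

Set Implicit Arguments.
Unset Strict Implicit.
Unset Printing Implicit Defensive.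

Import Order.TTheory GRing.Theory Num.Theory.

(** * Occurrences of length-three patterns as triples of indices *)

Lemma card_bij_pred (T1 T2 : finType) (f : T1 -> T2) (P : pred T1)
    (Q : pred T2) :
  bijective f -> (forall x, P x = Q (f x)) ->
  #|[set x | P x]| = #|[set y | Q y]|.
Proof.
move=> f_bij PQ.
rewrite -(@on_card_preimset _ _ f [set y | Q y]).
  by apply: eq_card => x; rewrite !inE PQ.
by apply: onW_bij.
Qed.

Definition in_gap (x y z a t : nat) : bool :=
  nth false [:: t < x; x < t < y; y < t < z; z < t] a.

(* p lists the positions, v the values, both in increasing order. *)
Definition unshaded n (R : {set 'I_4 * 'I_4}) (pi : 'S_n)
    (p v : nat * nat * nat) : bool :=
  [forall c in R, forall m : 'I_n,
    ~~ (in_gap p.1.1 p.1.2 p.2 c.1 m && in_gap v.1.1 v.1.2 v.2 c.2 (pi m))].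

Definition occ123 n R (pi : 'S_n) (t : 'I_n * 'I_n * 'I_n) : bool :=
  let: (i, j, k) := t in
  [&& i < j < k, pi i < pi j < pi k
    & unshaded R pi (i : nat, j : nat, k : nat)
                    (pi i : nat, pi j : nat, pi k : nat)].

Definition occ321 n R (pi : 'S_n) (t : 'I_n * 'I_n * 'I_n) : bool :=
  let: (i, j, k) := t in
  [&& i < j < k, pi k < pi j < pi i
    & unshaded R pi (i : nat, j : nat, k : nat)
                    (pi k : nat, pi j : nat, pi i : nat)].

Lemma grid_line3 n x y z a t : a < 4 -> t < n ->
  (grid_line n [:: x.+1; y.+1; z.+1] a < t.+1
     < grid_line n [:: x.+1; y.+1; z.+1] a.+1) = in_gap x y z a t.
Proof.
by case: a => [|[|[|[|]]]] //= _ tn; rewrite /grid_line /in_gap /= ?ltnS ?tn ?andbT.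
Qed.

Definition o0 : 'I_3 := ord0.
Definition o1 : 'I_3 := Ordinal (isT : 1 < 3).
Definition o2 : 'I_3 := Ordinal (isT : 2 < 3).

Lemma enum_ord3 : enum 'I_3 = [:: o0; o1; o2].
Proof. by apply: (inj_map val_inj); rewrite val_enum_ord. Qed.

Lemma forall_ord3 (P : pred 'I_3) : [forall a, P a] = [&& P o0, P o1 & P o2].
Proof.
apply/forallP/and3P => [h|[P0 P1 P2] a]; first by [].
have: a \in enum 'I_3 by rewrite mem_enum.
by rewrite enum_ord3 !inE => /or3P[]/eqP->.
Qed.

Definition triple n (f : {ffun 'I_3 -> 'I_n}) : 'I_n * 'I_n * 'I_n :=
  (f o0, f o1, f o2).

Lemma triple_bij n : bijective (@triple n).
Proof.
pose g (t : 'I_n * 'I_n * 'I_n) := [ffun a : 'I_3 => nth t.2 [:: t.1.1; t.1.2] a].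
exists g => [f|[[i j] k]]; last by rewrite /triple !ffunE.
apply/ffunP => -[[|[|[|]]] // h]; rewrite ffunE /=; congr (f _); exact: val_inj.
Qed.

Lemma sorted_values3 (x y z : nat) : x < y < z ->
  sort leq [:: x; y; z] = [:: x; y; z] /\ sort leq [:: z; y; x] = [:: x; y; z].
Proof.
move=> /andP[xy yz].
have s : sort leq [:: x; y; z] = [:: x; y; z].
  by apply: sorted_sort; [exact: leq_trans | rewrite /= (ltnW xy) (ltnW yz)].
split=> //; rewrite -[RHS]s; apply/perm_sortP.
- exact: leq_total.
- exact: leq_trans.
- exact: anti_leq.
- by rewrite -[[:: z; y; x]]/(rev [:: x; y; z]) perm_rev.
Qed.

Lemma box_empty3 n (pi : 'S_n) (f : {ffun 'I_3 -> 'I_n}) (c : 'I_4 * 'I_4)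
    (x y z : 'I_n) :
  occ_values pi f = [:: x.+1; y.+1; z.+1] ->
  box_empty pi f c.1 c.2 = [forall m : 'I_n,
    ~~ (in_gap (f o0) (f o1) (f o2) c.1 m && in_gap x y z c.2 (pi m))].
Proof.
move=> vals; rewrite /box_empty vals /occ_positions enum_ord3 /= negb_exists.
by apply: eq_forallb => m; rewrite !grid_line3.
Qed.

(** The comparisons of neighbouring entries decide, by transitivity, every comparison required by
    [order_isomorphic]. *)
Lemma occurrence123 n R (pi : 'S_n) f :
  @occurrence n 3 (perm123, R) pi f = occ123 R pi (triple f).
Proof.
rewrite /occurrence /order_isomorphic /occ123 /= !forall_ord3 !perm1 /= !ltnn /=.
case h1 : (f o0 < f o1); rewrite /= ?andbF //.
case h2 : (f o1 < f o2); rewrite /= ?andbF //.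
have h3 : f o0 < f o2 by lia.
rewrite h3 /=.
case v1 : (pi (f o0) < pi (f o1)); rewrite /= ?andbF //.
case v2 : (pi (f o1) < pi (f o2)); rewrite /= ?andbF //.
have -> : (pi (f o0) < pi (f o2)) by lia.
have -> : (pi (f o1) < pi (f o0)) = false by lia.
have -> : (pi (f o2) < pi (f o0)) = false by lia.
have -> : (pi (f o2) < pi (f o1)) = false by lia.
rewrite /=; apply: eq_forallb => c; congr (_ ==> _).
apply: box_empty3; rewrite /occ_values enum_ord3 /=.
by rewrite (proj1 (@sorted_values3 _ _ _ _)) // !ltnS v1.
Qed.

Lemma occurrence321 n R (pi : 'S_n) f :
  @occurrence n 3 (perm321, R) pi f = occ321 R pi (triple f).
Proof.
rewrite /occurrence /order_isomorphic /occ321 /= !forall_ord3 !permE /= !ltnn /=.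
case h1 : (f o0 < f o1); rewrite /= ?andbF //.
case h2 : (f o1 < f o2); rewrite /= ?andbF //.
have h3 : f o0 < f o2 by lia.
rewrite h3 /=.
case v1 : (pi (f o1) < pi (f o0)); rewrite /= ?andbF //.
case v2 : (pi (f o2) < pi (f o1)); rewrite /= ?andbF //.
have -> : (pi (f o2) < pi (f o0)) by lia.
have -> : (pi (f o0) < pi (f o1)) = false by lia.
have -> : (pi (f o0) < pi (f o2)) = false by lia.
have -> : (pi (f o1) < pi (f o2)) = false by lia.
rewrite /=; apply: eq_forallb => c; congr (_ ==> _).
apply: box_empty3; rewrite /occ_values enum_ord3 /=.
by rewrite (proj2 (@sorted_values3 _ _ _ _)) // !ltnS v2.
Qed.

Lemma occurrences123 n R (pi : 'S_n) :
  occurrences ((perm123, R) : mesh_pattern 3) pi = #|[set t | occ123 R pi t]|.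
Proof. by apply: card_bij_pred (triple_bij n) _ => f; apply: occurrence123. Qed.

Lemma occurrences321 n R (pi : 'S_n) :
  occurrences ((perm321, R) : mesh_pattern 3) pi = #|[set t | occ321 R pi t]|.
Proof. by apply: card_bij_pred (triple_bij n) _ => f; apply: occurrence321. Qed.

(** * Symmetries: inverse and complement *)

Definition inv_boxes (R : {set 'I_4 * 'I_4}) := [set c | (c.2, c.1) \in R].
Definition compl_boxes (R : {set 'I_4 * 'I_4}) :=
  [set c | (c.1, rev_ord c.2) \in R].

Definition compl n (pi : 'S_n) : 'S_n := (pi * perm (@rev_ord_inj n))%g.

Lemma complE n (pi : 'S_n) i : compl pi i = rev_ord (pi i).
Proof. by rewrite permM permE. Qed.

Lemma compl_inj n : injective (@compl n).
Proof. exact: mulIg. Qed.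

(** Inversion reflects the plot in the diagonal: the point over [m] becomes the point over [pi m],
    with rows and columns exchanged. *)
Lemma unshaded_inv n R (pi : 'S_n) p v :
  unshaded (inv_boxes R) (pi^-1)%g v p = unshaded R pi p v.
Proof.
apply/forall_inP/forall_inP => h [a b] cR; apply/forallP => m /=.
  have /h/forallP/(_ (pi m)) : (b, a) \in inv_boxes R by rewrite inE.
  by rewrite permK andbC.
move: cR; rewrite inE => /h/forallP/(_ ((pi^-1)%g m)) /=.
by rewrite permKV andbC.
Qed.

Lemma in_gap_rev n (x y z t : 'I_n) (a : 'I_4) :
  in_gap (rev_ord z) (rev_ord y) (rev_ord x) (rev_ord a) (rev_ord t)
  = in_gap x y z a t.
Proof.
case: x y z t => x hx [y hy] [z hz] [t ht].
by case: a => -[|[|[|[|]]]] //= _; rewrite /in_gap /=; lia.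
Qed.

Lemma unshaded_compl n R (pi : 'S_n) p (u v w : 'I_n) :
  unshaded (compl_boxes R) (compl pi) p
    (rev_ord w : nat, rev_ord v : nat, rev_ord u : nat)
  = unshaded R pi p (u : nat, v : nat, w : nat).
Proof.
apply/forall_inP/forall_inP => h [a b] cR; apply/forallP => m /=.
  have /h/forallP/(_ m) : (a, rev_ord b) \in compl_boxes R.
    by rewrite inE rev_ordK.
  by rewrite complE /= in_gap_rev.
move: cR; rewrite inE => /h/forallP/(_ m) /=.
by rewrite complE -{2}(rev_ordK b) in_gap_rev.
Qed.

Lemma ltn_rev n (x y : 'I_n) : (rev_ord x < rev_ord y) = (y < x).
Proof. by case: x y => x hx [y hy] /=; lia. Qed.

Lemma occurrences123_inv n R (pi : 'S_n) :
  occurrences ((perm123, inv_boxes R) : mesh_pattern 3) (pi^-1)%g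
  = occurrences ((perm123, R) : mesh_pattern 3) pi.
Proof.
rewrite !occurrences123; symmetry.
apply: (@card_bij_pred _ _ (fun t => (pi t.1.1, pi t.1.2, pi t.2))).
  exists (fun t => ((pi^-1)%g t.1.1, (pi^-1)%g t.1.2, (pi^-1)%g t.2));
  by move=> [[i j] k] /=; rewrite ?permK ?permKV.
by move=> [[i j] k]; rewrite /occ123 !permK unshaded_inv andbCA.
Qed.

Lemma occurrences321_inv n R (pi : 'S_n) :
  occurrences ((perm321, inv_boxes R) : mesh_pattern 3) (pi^-1)%g
  = occurrences ((perm321, R) : mesh_pattern 3) pi.
Proof.
rewrite !occurrences321; symmetry.
(* The values of a 321 decrease, so they are listed backwards to become increasing positions of the
   inverse. *)
apply: (@card_bij_pred _ _ (fun t => (pi t.2, pi t.1.2, pi t.1.1))).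
  exists (fun t => ((pi^-1)%g t.2, (pi^-1)%g t.1.2, (pi^-1)%g t.1.1));
  by move=> [[i j] k] /=; rewrite ?permK ?permKV.
by move=> [[i j] k]; rewrite /occ321 !permK unshaded_inv andbCA.
Qed.

Lemma occurrences321_compl n R (pi : 'S_n) :
  occurrences ((perm321, compl_boxes R) : mesh_pattern 3) (compl pi)
  = occurrences ((perm123, R) : mesh_pattern 3) pi.
Proof.
rewrite occurrences123 occurrences321; apply: eq_card => -[[i j] k].
by rewrite !inE /occ321 /occ123 !complE !ltn_rev unshaded_compl (andbC (pi j < _)).
Qed.

Lemma occurrences123_compl n R (pi : 'S_n) :
  occurrences ((perm123, compl_boxes R) : mesh_pattern 3) (compl pi)
  = occurrences ((perm321, R) : mesh_pattern 3) pi.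
Proof.
rewrite occurrences123 occurrences321; apply: eq_card => -[[i j] k].
by rewrite !inE /occ321 /occ123 !complE !ltn_rev unshaded_compl (andbC (pi j < _)).
Qed.

Definition joint_mono (R : {set 'I_4 * 'I_4}) (n k l : nat) : nat :=
  joint_count ((perm123, R) : mesh_pattern 3) ((perm321, R) : mesh_pattern 3)
    n k l.

Lemma joint_mono_inv R n k l :
  joint_mono (inv_boxes R) n k l = joint_mono R n k l.
Proof.
symmetry; apply: (@card_bij_pred _ _ (fun pi : 'S_n => pi^-1)%g).
  by exists (fun pi : 'S_n => pi^-1)%g; exact: invgK.
by move=> pi; rewrite occurrences123_inv occurrences321_inv.
Qed.

Lemma joint_mono_compl R n k l :
  joint_mono (compl_boxes R) n k l = joint_mono R n l k.
Proof.
symmetry; apply: (@card_bij_pred _ _ (@compl n)).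
  exact: injF_bij (@compl_inj n).
by move=> pi; rewrite occurrences123_compl occurrences321_compl andbC.
Qed.

(* With A19 as base point, complement and inversion generate the whole list. *)
Lemma A17E : A17 = inv_boxes A19.
Proof.
by apply/setP=> -[[[|[|[|[|]]]] // ?] [[|[|[|[|]]]] // ?]]; rewrite !inE.
Qed.

Lemma A18E : A18 = compl_boxes A17.
Proof.
by apply/setP=> -[[[|[|[|[|]]]] // ?] [[|[|[|[|]]]] // ?]]; rewrite !inE.
Qed.

Lemma A20E : A20 = inv_boxes A18.
Proof.
by apply/setP=> -[[[|[|[|[|]]]] // ?] [[|[|[|[|]]]] // ?]]; rewrite !inE.
Qed.

Lemma A24E : A24 = compl_boxes A19.
Proof.
by apply/setP=> -[[[|[|[|[|]]]] // ?] [[|[|[|[|]]]] // ?]]; rewrite !inE.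
Qed.

Lemma A23E : A23 = compl_boxes A20.
Proof.
by apply/setP=> -[[[|[|[|[|]]]] // ?] [[|[|[|[|]]]] // ?]]; rewrite !inE.
Qed.

Lemma A21E : A21 = inv_boxes A24.
Proof.
by apply/setP=> -[[[|[|[|[|]]]] // ?] [[|[|[|[|]]]] // ?]]; rewrite !inE.
Qed.

Lemma A22E : A22 = inv_boxes A23.
Proof.
by apply/setP=> -[[[|[|[|[|]]]] // ?] [[|[|[|[|]]]] // ?]]; rewrite !inE.
Qed.

(** * Records on either side of the minimum, and insertion of a second smallest letter *)

Definition min_pos m (s : 'S_m.+1) : 'I_m.+1 := (s^-1)%g ord0.

(** Positions of the right-to-left maxima of the word before the smallest letter. *)
Definition left_records m (s : 'S_m.+1) : {set 'I_m.+1} :=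
  [set i : 'I_m.+1 | (i < min_pos s)
     && [forall j : 'I_m.+1, (i < j < min_pos s) ==> (s j < s i)]].

(** Positions of the left-to-right maxima of the word after the smallest letter. *)
Definition right_records m (s : 'S_m.+1) : {set 'I_m.+1} :=
  [set i : 'I_m.+1 | (min_pos s < i)
     && [forall j : 'I_m.+1, (min_pos s < j < i) ==> (s j < s i)]].

(** [lift ord0 ord0] is the value 1: the minimum 0 keeps its value and all other letters move up by
    one. *)
Definition insert_second m (i0 : 'I_m.+2) (s : 'S_m.+1) : 'S_m.+2 :=
  lift_perm i0 (lift ord0 ord0) s.

Lemma perm_min_pos m (s : 'S_m.+1) : s (min_pos s) = ord0.
Proof. exact: permKV. Qed.

Lemma min_pos_eq m (s : 'S_m.+1) i : s i = ord0 -> min_pos s = i.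
Proof. by move=> si; rewrite /min_pos -si permK. Qed.

Lemma perm_gt0 m (s : 'S_m.+1) i : (0 < s i) = (i != min_pos s).
Proof.
rewrite -(inj_eq (@perm_inj _ s)) perm_min_pos lt0n.
by rewrite -(inj_eq val_inj).
Qed.

Lemma min_pos_insert m i0 (s : 'S_m.+1) :
  min_pos (insert_second i0 s) = lift i0 (min_pos s).
Proof.
apply: min_pos_eq; rewrite lift_perm_lift perm_min_pos; exact: val_inj.
Qed.

Lemma card_ord_lift n (i0 : 'I_n.+1) (P : pred 'I_n.+1) :
  #|[set i | P i]| = P i0 + #|[set i | P (lift i0 i)]|.
Proof.
by rewrite -!sum1dep_card big_mkcond (bigD1_ord i0) //= -big_mkcond; case: (P i0).
Qed.

Lemma forall_ord_lift n (i0 : 'I_n.+1) (P : pred 'I_n.+1) :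
  [forall i, P i] = P i0 && [forall i, P (lift i0 i)].
Proof.
apply/forallP/andP => [h|[P0 /forallP h] i]; first by split=> //; apply/forallP.
by case: (unliftP i0 i) => [j|] ->.
Qed.

Lemma ltn_bump h i j : (bump h i < bump h j) = (i < j).
Proof. by rewrite /bump; case: (leqP h i); case: (leqP h j); lia. Qed.

(** The new letter is below every letter except the minimum, so it destroys no record and is itself
    a left record only when the minimum follows it at once. *)
Lemma card_left_insert m i0 (s : 'S_m.+1) :
  #|left_records (insert_second i0 s)|
  = (i0 == min_pos s :> nat) + #|left_records s|.
Proof.
rewrite {1}/left_records (card_ord_lift i0) min_pos_insert; congr (_ + _).
  congr nat_of_bool; apply/andP/eqP => [[]|] /=; rewrite /bump.
    move=> i0p /forallP h.
    have {}i0p : i0 <= min_pos s by lia.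
    apply/eqP; rewrite eqn_leq i0p leqNgt; apply/negP => ip.
    have pm : i0 < m.+1 by have := ltn_ord (min_pos s); lia.
    (* This is the letter right after the inserted one; it precedes the minimum and is larger, so
       the inserted letter is no record. *)
    have := h (lift i0 (Ordinal pm)).
    rewrite lift_perm_id lift_perm_lift /= /bump.
    have := perm_gt0 s (Ordinal pm).
    rewrite -(inj_eq val_inj) /=; lia.
  move=> ip; split; first by rewrite ip; lia.
  by apply/forallP => j; apply/implyP; rewrite ip; lia.
apply: eq_card => i; rewrite !inE /= ltn_bump.
case: (ltnP i (min_pos s)) => //= ip.
rewrite (forall_ord_lift i0) lift_perm_id !lift_perm_lift /=.
have si : 0 < s i by rewrite perm_gt0 -(inj_eq val_inj) neq_ltn ip.
have -> : (bump 0 0 < bump (bump 0 0) (s i)) = true by rewrite /bump; lia.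
rewrite implybT /=; apply: eq_forallb => j.
by rewrite /insert_second lift_perm_lift /= !ltn_bump.
Qed.

(** Mirror case: the new letter is a record only immediately after the minimum, at [(min_pos s).+1],
    since an insertion to the right does not move the minimum. *)
Lemma card_right_insert m i0 (s : 'S_m.+1) :
  #|right_records (insert_second i0 s)|
  = (i0 == (min_pos s).+1 :> nat) + #|right_records s|.
Proof.
rewrite {1}/right_records (card_ord_lift i0) min_pos_insert; congr (_ + _).
  congr nat_of_bool; apply/andP/eqP => [[]|] /=; rewrite /bump.
    move=> i0p /forallP h.
    have {}i0p : min_pos s < i0 by lia.
    have p1 : (min_pos s).+1 < m.+2 by have := ltn_ord (min_pos s); lia.
    apply/eqP; rewrite eqn_leq i0p andbT leqNgt; apply/negP => ip.
    have pm : (min_pos s).+1 < m.+1 by have := ltn_ord i0; lia.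
    have := h (lift i0 (Ordinal pm)).
    rewrite lift_perm_id lift_perm_lift /= /bump.
    have := perm_gt0 s (Ordinal pm).
    rewrite -(inj_eq val_inj) /= ; lia.
  move=> ip; split; first by rewrite ip; lia.
  by apply/forallP => j; apply/implyP; rewrite ip; lia.
apply: eq_card => i; rewrite !inE /= ltn_bump.
case: (ltnP (min_pos s) i) => //= ip.
rewrite (forall_ord_lift i0) lift_perm_id !lift_perm_lift /=.
have si : 0 < s i by rewrite perm_gt0 -(inj_eq val_inj) neq_ltn ip orbT.
have -> : (bump 0 0 < bump (bump 0 0) (s i)) = true by rewrite /bump; lia.
rewrite implybT /=; apply: eq_forallb => j.
by rewrite /insert_second lift_perm_lift /= !ltn_bump.
Qed.

(** The position of the value 1 recovers the insertion position, which gives injectivity;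
    surjectivity is the count (m+2)(m+1)! = (m+2)!. *)
Lemma insert_second_bij m :
  bijective (fun t : 'I_m.+2 * 'S_m.+1 => insert_second t.1 t.2).
Proof.
apply: inj_card_bij; last by rewrite card_prod !card_Sn card_ord -factS.
move=> [i s] [i' s'] /= E.
have ii : i = i'.
  apply: (@perm_inj _ (insert_second i s)).
  by rewrite {2}E /insert_second !lift_perm_id.
subst i'; congr (_, _); apply/permP => k.
have := congr1 (fun u : 'S_m.+2 => u (lift i k)) E.
by rewrite /insert_second !lift_perm_lift => /lift_inj.
Qed.

Definition records_count m i j : nat :=
  #|[set s : 'S_m.+1 | (#|left_records s| == i) && (#|right_records s| == j)]|.

(** Serves the sum over insertion positions: one slot just before the minimum, one just after, and
    [m] neutral ones. *)
Lemma sum_ord_two_special m p (a b c : nat) : p <= m ->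
  \sum_(i < m.+2) (if i == p :> nat then a else if i == p.+1 :> nat then b else c)
  = a + b + m * c.
Proof.
move=> pm.
rewrite -(big_mkord xpredT (fun i => if i == p then a else if i == p.+1 then b else c)).
rewrite (@big_cat_nat _ _ _ p) //=; last by lia.
rewrite [X in _ + X = _]big_ltn ?(@big_ltn _ _ _ p.+1); try lia.
rewrite !eqxx.
have E q r (F : nat -> nat) : (forall i, q <= i < r -> F i = c) ->
    \sum_(q <= i < r) F i = (r - q) * c.
  by move=> Fc; rewrite (eq_big_nat _ _ Fc) sum_nat_const_nat.
rewrite !E; first by rewrite -[p.+1 == p]/(p.+1 == p) gtn_eqF //; nia.
- by move=> i ip; case: (i =P p); case: (i =P p.+1); lia.
- by move=> i ip; case: (i =P p); case: (i =P p.+1); lia.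
Qed.

Lemma records_countS m i j :
  records_count m.+1 i j = m * records_count m i j
    + (if i is i'.+1 then records_count m i' j else 0)
    + (if j is j'.+1 then records_count m i j' else 0).
Proof.
(* [c s a b] tests whether [s] reaches the counts [i] and [j] after gaining [a] left and [b] right
   records. *)
pose c (s : 'S_m.+1) a b := ((#|left_records s| + a == i)
  && (#|right_records s| + b == j) : nat).
transitivity (\sum_(s : 'S_m.+1) (c s 1 0 + c s 0 1 + m * c s 0 0)).
  rewrite /records_count -(card_bij_pred (insert_second_bij m) (fun=> erefl)).
  rewrite -sum1dep_card big_mkcond /=.
  rewrite -(pair_bigA _ (fun i0 s => if (#|left_records (insert_second i0 s)| == i)
     && (#|right_records (insert_second i0 s)| == j) then 1 else 0)) /=.
  rewrite exchange_big /=; apply: eq_bigr => s _.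
  rewrite -(@sum_ord_two_special m (min_pos s)) ?(leq_ord (min_pos s)) //.
  apply: eq_bigr => i0 _; rewrite card_left_insert card_right_insert /c.
  rewrite ![in LHS](addnC (nat_of_bool _)).
  case: (eqVneq (i0 : nat) (min_pos s)) => [->|_].
    by rewrite (ltn_eqF (ltnSn _)); case: ifP.
  by case: (_ == (min_pos s).+1); case: ifP.
rewrite !big_split /= -big_distrr /= addnC addnA; congr (_ + _ + _).
- congr (_ * _); rewrite /records_count -sum1dep_card [RHS]big_mkcond.
  by apply: eq_bigr => s _; rewrite /c !addn0; case: ifP.
- rewrite /c; case: i {c} => [|i].
    by rewrite big1 // => s _; rewrite addn1.
  rewrite /records_count -sum1dep_card [RHS]big_mkcond.
  by apply: eq_bigr => s _; rewrite addn1 addn0 eqSS; case: ifP.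
- rewrite /c; case: j {c} => [|j].
    by rewrite big1 // => s _; rewrite addn1 andbF.
  rewrite /records_count -sum1dep_card [RHS]big_mkcond.
  by apply: eq_bigr => s _; rewrite addn1 addn0 eqSS; case: ifP.
Qed.

(** In the recurrence the two shifted terms carry the same Stirling number, at i+j-1, and their
    binomials add up by Pascal's rule; the term with factor [m] supplies the rest of the Stirling
    recurrence. *)
Lemma records_countE m i j :
  records_count m i j = 'C(i + j, i) * stirling1 m (i + j).
Proof.
elim: m i j => [|m IH] i j.
  have rec0 (s : 'S_1) : #|left_records s| = 0 /\ #|right_records s| = 0.
    by split; apply/eqP; rewrite cards_eq0; apply/eqP/setP => x;
      rewrite !inE (ord1 x) (ord1 (min_pos s)).
  rewrite /records_count.
  have -> : [set s : 'S_1 | (#|left_records s| == i) && (#|right_records s| == j)]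
            = [set s | (0 == i) && (0 == j)].
    by apply/setP => s; rewrite !inE; case: (rec0 s) => -> ->.
  case: i => [|i]; last by rewrite addSn /= muln0; apply: eq_card0 => s; rewrite !inE.
  case: j => [|j]; last by rewrite add0n /= muln0; apply: eq_card0 => s; rewrite !inE.
  have -> : [set s : 'S_1 | (0 == 0) && (0 == 0)] = setT by apply/setP => s; rewrite !inE.
  by rewrite cardsT card_Sn.
rewrite records_countS IH; case: i j => [|i] [|j]; rewrite ?IH.
(* For [i = j = 0], the product [m * stirling1 m 0] vanishes through its first factor if [m = 0] and
   through its second otherwise. *)
- by rewrite !addn0; case: m {IH} => [|m] //=; rewrite !muln0.
- by rewrite !add0n !bin0 !mul1n /= addn0.
- by rewrite !addn0 !binn !mul1n /=.
- rewrite !addSn !addnS /= binS; nia.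
Qed.

(** * Occurrences under the shading [A19] *)

Lemma unshaded_boxes n l (pi : 'S_n) p v :
  all (fun c => (c.1 < 4) && (c.2 < 4)) l ->
  unshaded (boxes l) pi p v = [forall m : 'I_n, all (fun c =>
    ~~ (in_gap p.1.1 p.1.2 p.2 c.1 m && in_gap v.1.1 v.1.2 v.2 c.2 (pi m))) l].
Proof.
move=> /allP l4; apply/forall_inP/forallP => h.
  move=> m; apply/allP => -[a b] cl; have /andP[/= a4 b4] := l4 _ cl.
  have /h/forallP/(_ m) // : (Ordinal a4, Ordinal b4) \in boxes l by rewrite inE.
move=> c; rewrite inE => cl; apply/forallP => m.
by have /allP/(_ _ cl) := h m.
Qed.

(** The fully shaded bottom row, the fully shaded column 1 and the box (2,3) give the three
    conjuncts in this order. The equalities remain because a point on a grid line lies in no box. *)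
Lemma A19_box i j k u v w x y : i < j < k -> u < v < w ->
  all (fun c => ~~ (in_gap i j k c.1 x && in_gap u v w c.2 y))
   [:: (0, 0); (1, 0); (2, 0); (3, 0); (1, 1); (1, 2); (1, 3); (2, 3)]
  = [&& [|| x == i, x == j, x == k | u <= y],
        (i < x < j) ==> [|| y == u, y == v | y == w]
      & (j < x < k) ==> (y <= w)].
Proof.
move=> ijk uvw; rewrite /in_gap /=.
case: (ltngtP x i) => xi; case: (ltngtP x j) => xj; case: (ltngtP x k) => xk;
  try (exfalso; lia); rewrite /= ?andbT;
  case: (ltngtP y u) => yu; case: (ltngtP y v) => yv; case: (ltngtP y w) => yw //=;
  exfalso; lia.
Qed.

Lemma unshaded_A19 n (pi : 'S_n) (i j k u v w : 'I_n) :
  i < j < k -> u < v < w ->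
  unshaded A19 pi (i : nat, j : nat, k : nat) (u : nat, v : nat, w : nat)
  = [forall m : 'I_n,
      [&& [|| m == i, m == j, m == k | u <= pi m],
          (i < m < j) ==> [|| pi m == u, pi m == v | pi m == w]
        & (j < m < k) ==> (pi m <= w)]].
Proof.
move=> ijk uvw; rewrite unshaded_boxes //; apply: eq_forallb => m.
by rewrite A19_box.
Qed.

Lemma ltn_neq_leq n (s : 'S_n) x y : x != y -> (s x < s y) = (s x <= s y).
Proof. by move=> xy; rewrite ltn_neqAle val_eqE (inj_eq perm_inj) xy. Qed.

Lemma min_pos_uniq m (s : 'S_m.+1) i :
  (forall x, x != i -> s i < s x) -> min_pos s = i.
Proof.
move=> h; apply/eqP/negPn/negP => /h.
by rewrite perm_min_pos.
Qed.

Lemma ord_succ n (i j : 'I_n) : i < j ->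
  (forall x : 'I_n, i < x -> j <= x) -> (j : nat) = i.+1.
Proof.
move=> ij h; have i1 : i.+1 < n by have := ltn_ord j; lia.
by have /= := h (Ordinal i1); lia.
Qed.

(** The bottom row makes the lowest letter the minimum of [pi], column 1 makes the first two
    positions adjacent, and box (2,3) turns the last letter into a record. The condition [k != j]
    excludes the first letter after the minimum, a trivial record. *)
Lemma occ123_A19 m (pi : 'S_m.+1) i j k :
  occ123 A19 pi (i, j, k)
  = [&& i == min_pos pi, j == i.+1 :> nat, k != j & k \in right_records pi].
Proof.
rewrite /occ123 inE; apply/and3P/and4P => [[ijk vijk]|].
  rewrite unshaded_A19 // => /forallP h.
  have ip : min_pos pi = i.
    apply: min_pos_uniq => x xi; rewrite ltn_neq_leq 1?eq_sym //.
    have /and3P[/or4P[/eqP E|/eqP->|/eqP->|] //] := h x; try lia.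
    by rewrite E eqxx in xi.
  have ji : (j : nat) = i.+1.
    apply: ord_succ => [|x ix]; first by lia.
    rewrite leqNgt; apply/negP => xj.
    have /and3P[_ + _] := h x; rewrite ix xj /= !(inj_eq perm_inj).
    by case/or3P => /eqP E; move: ix xj ijk; rewrite E; lia.
  rewrite ip ji !eqxx; split=> //; first by rewrite -val_eqE /=; lia.
  apply/andP; split; first by lia.
  apply/forallP => x; apply/implyP => /andP[ix xk].
  have [->|xj] := eqVneq x j; first by lia.
  rewrite ltn_neq_leq ?neq_ltn ?xk //.
  have /and3P[_ _ /implyP] := h x; apply.
  by move: xj; rewrite -val_eqE /=; lia.
case=> /eqP ip /eqP ji kj; rewrite -ip => /andP[ik /forallP h].
have jk : j < k by move: kj; rewrite -val_eqE /=; lia.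
have pjk : pi j < pi k by have := h j; rewrite jk ji ltnSn.
have pi0 : pi i = ord0 by rewrite ip perm_min_pos.
have pij : pi i < pi j.
  by rewrite pi0 perm_gt0 -ip -val_eqE /= ji gtn_eqF.
have ijk : i < j < k by rewrite ji ltnSn -ji.
have vijk : pi i < pi j < pi k by rewrite pij.
split=> //; rewrite unshaded_A19 //; apply/forallP => x.
rewrite pi0 leq0n !orbT /=; apply/andP; split; apply/implyP; first by lia.
move=> /andP[jx xk]; apply: ltnW; have /implyP := h x; apply; lia.
Qed.

(** The same three constraints apply, but the minimum is now the last letter, and box (2,3) bounds
    the letters between [j] and [k] by [pi i], so the record is at [i]. *)
Lemma occ321_A19 m (pi : 'S_m.+1) i j k :
  occ321 A19 pi (i, j, k)
  = [&& k == min_pos pi, j == i.+1 :> nat, j != k & i \in left_records pi].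
Proof.
rewrite /occ321 inE; apply/and3P/and4P => [[ijk vijk]|].
  rewrite unshaded_A19 // => /forallP h.
  have kp : min_pos pi = k.
    apply: min_pos_uniq => x xk; rewrite ltn_neq_leq 1?eq_sym //.
    have /and3P[/or4P[/eqP->|/eqP->|/eqP E|] //] := h x; try lia.
    by rewrite E eqxx in xk.
  have ji : (j : nat) = i.+1.
    apply: ord_succ => [|x ix]; first by lia.
    rewrite leqNgt; apply/negP => xj.
    have /and3P[_ + _] := h x; rewrite ix xj /= !(inj_eq perm_inj).
    by case/or3P => /eqP E; move: ix xj ijk; rewrite E; lia.
  rewrite kp ji !eqxx; split=> //; first by rewrite -val_eqE /=; lia.
  apply/andP; split; first by lia.
  apply/forallP => x; apply/implyP => /andP[ix xk].
  have [->|xj] := eqVneq x j; first by lia.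
  rewrite ltn_neq_leq ?neq_ltn ?ix ?orbT //.
  have /and3P[_ _ /implyP] := h x; apply.
  by move: xj; rewrite -val_eqE /=; lia.
case=> /eqP kp /eqP ji kj; rewrite -kp => /andP[ik /forallP h].
have jk : j < k by move: kj; rewrite -val_eqE /=; lia.
have pji : pi j < pi i by have := h j; rewrite jk ji ltnSn.
have pi0 : pi k = ord0 by rewrite kp perm_min_pos.
have pkj : pi k < pi j.
  by rewrite pi0 perm_gt0 -kp.
have ijk : i < j < k by rewrite ji ltnSn -ji.
have vijk : pi k < pi j < pi i by rewrite pkj.
split=> //; rewrite unshaded_A19 //; apply/forallP => x.
rewrite pi0 leq0n !orbT /=; apply/andP; split; apply/implyP; first by lia.
move=> /andP[jx xk]; apply: ltnW; have /implyP := h x; apply; lia.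
Qed.

Lemma occurrences123_A19 m (pi : 'S_m.+1) :
  occurrences ((perm123, A19) : mesh_pattern 3) pi = #|right_records pi|.-1.
Proof.
rewrite occurrences123.
(* With the minimum at the last position there are no right records and no occurrences, and the
   predecessor of 0 is 0. *)
have [pm|pm] := ltnP (min_pos pi).+1 m.+1; last first.
  have -> : right_records pi = set0.
    by apply/setP => x; rewrite !inE; have := ltn_ord x; lia.
  rewrite cards0; apply: eq_card0 => -[[i j] k]; rewrite inE occ123_A19.
  apply/negP => /and4P[/eqP-> /eqP ji _ _]; have := ltn_ord j; lia.
pose p1 := Ordinal pm.
have -> : [set t | occ123 A19 pi t]
    = (fun k => (min_pos pi, p1, k)) @: (right_records pi :\ p1).
  apply/setP => -[[i j] k]; rewrite inE occ123_A19.
  apply/and4P/imsetP => [[/eqP-> jp kj kr]|[x /setD1P[xp xr] [-> -> ->]]].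
    have jE : j = p1 by apply: val_inj; apply/eqP.
    by exists k; [rewrite in_setD1 -jE kj | rewrite jE].
  by split.
rewrite card_imset => [|x y []] //.
rewrite (cardsD1 p1 (right_records pi)) inE ltnSn /=.
suff -> : [forall j : 'I_m.+1, (min_pos pi < j < p1) ==> (pi j < pi p1)] by [].
by apply/forallP => x /=; lia.
Qed.

Lemma occurrences321_A19 m (pi : 'S_m.+1) :
  occurrences ((perm321, A19) : mesh_pattern 3) pi = #|left_records pi|.-1.
Proof.
rewrite occurrences321.
have [p0|p0] := posnP (min_pos pi).
  have -> : left_records pi = set0.
    by apply/setP => x; rewrite !inE p0.
  rewrite cards0; apply: eq_card0 => -[[i j] k]; rewrite !inE occ321_A19.
  by rewrite inE p0 !andbF.
have pm : (min_pos pi).-1 < m.+1 by have := ltn_ord (min_pos pi); lia.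
pose p1 := Ordinal pm.
(* [p1] ends the word before the minimum; any other record [i] has [i.+1] before the minimum, so
   [inord] is exact. *)
have -> : [set t | occ321 A19 pi t]
    = (fun i : 'I_m.+1 => (i, inord i.+1, min_pos pi)) @: (left_records pi :\ p1).
  apply/setP => -[[i j] k]; rewrite inE occ321_A19.
  apply/and4P/imsetP => [[/eqP-> /eqP ji jk ir]|[x /setD1P[xp xr] [-> -> ->]]].
    exists i; last by congr (_, _, _); apply: val_inj; rewrite /= inordK -ji.
    rewrite !inE in ir *; rewrite ir andbT -val_eqE /=.
    by move: jk; rewrite -val_eqE /=; lia.
  have xp' : x.+1 < min_pos pi.
    by move: xp xr; rewrite !inE -val_eqE /=; lia.
  have xm : x.+1 < m.+1 by have := ltn_ord (min_pos pi); lia.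
  by split=> //; rewrite -?val_eqE /= inordK // ltn_eqF.
rewrite card_imset => [|x y []] //.
rewrite (cardsD1 p1 (left_records pi)) inE /= ltn_predL p0.
suff -> : [forall j : 'I_m.+1, (p1 < j < min_pos pi) ==> (pi j < pi p1)] by [].
by apply/forallP => x /=; lia.
Qed.

(** * The joint distribution for [A19] and its transfer to the other shadings *)

Lemma joint_mono_A19 m k l :
  joint_mono A19 m.+1 k l = 'C(k + l + 2, k + 1) * stirling1 m (k + l + 2)
    + (k == 0) * stirling1 m (l + 1) + (l == 0) * stirling1 m (k + 1)
    + ((k == 0) && (l == 0)) * stirling1 m 0.
Proof.
pose c a b := \sum_(s : 'S_m.+1)
  ((#|left_records s| == a) && (#|right_records s| == b) : nat).
have cE a b : c a b = 'C(a + b, a) * stirling1 m (a + b).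
  rewrite -records_countE /records_count -sum1dep_card [RHS]big_mkcond.
  by apply: eq_bigr => s _; case: ifP.
(* The predecessor is truncated: zero occurrences arise from one record or from none, a positive
   number from exactly one record more. Hence the extra terms when [k] or [l] is 0. *)
transitivity (c l.+1 k.+1 + (k == 0) * c l.+1 0 + (l == 0) * c 0 k.+1
              + ((k == 0) && (l == 0)) * c 0 0).
  rewrite /joint_mono /joint_count -sum1dep_card big_mkcond /c.
  rewrite !big_distrr -!big_split; apply: eq_bigr => s _ /=.
  rewrite occurrences123_A19 occurrences321_A19.
  case: #|left_records s| => [|a]; case: #|right_records s| => [|b] /=;
    rewrite ?eqSS; case: k l => [|k] [|l]; rewrite /= ?andbT ?andbF //;
    by do ?case: (_ == _).
have E : k + l + 2 = l.+1 + k.+1 by lia.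
rewrite !cE !addn0 !add0n !binn bin0 !mul1n E !addn1.
by rewrite -(@bin_sub _ k.+1) ?leq_addl // addnK.
Qed.

Lemma joint_monoC_A19 n k l : joint_mono A19 n.+1 k l = joint_mono A19 n.+1 l k.
Proof.
rewrite !joint_mono_A19 (addnC l k) -(@bin_sub _ (k + 1)); last by lia.
have -> : k + l + 2 - (k + 1) = l + 1 by lia.
by rewrite (andbC (l == 0)); congr (_ + _); rewrite addnAC.
Qed.

(** Inversion preserves the joint count; complement swaps [k] and [l], which the symmetry for [A19]
    undoes. *)
Lemma joint_mono_eq R n k l :
  R \in [:: A17; A18; A19; A20; A21; A22; A23; A24] ->
  joint_mono R n.+1 k l = joint_mono A19 n.+1 k l.
Proof.
rewrite !inE => hR.
do 7?[case/orP: hR => [/eqP->|hR]]; last move/eqP: hR => ->;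
  by rewrite ?(A17E, A18E, A20E, A24E, A23E, A21E, A22E)
             ?(joint_mono_inv, joint_mono_compl) // joint_monoC_A19.
Qed.

(** * Stirling numbers, harmonic sums and the generating function *)

Lemma stirling1SS n k :
  stirling1 n.+1 k.+1 = n * stirling1 n k.+1 + stirling1 n k.
Proof. by []. Qed.

Lemma stirling1S1 m : stirling1 m.+1 1 = m`!.
Proof. by elim: m => // m IH; rewrite stirling1SS IH factS addn0. Qed.

Local Open Scope ring_scope.

(** Divided by the factorial, the Stirling recurrence adds one reciprocal per step, because c(m+1,1)
    = m!. *)
Lemma stirling1S2 m :
  (stirling1 m.+1 2)%:R = (m`!)%:R * \sum_(1 <= i < m.+1) i%:R^-1 :> rat.
Proof.
elim: m => [|m IH]; first by rewrite big_nil mulr0.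
rewrite stirling1SS stirling1S1 natrD natrM IH [in RHS]big_nat_recr //= factS natrM.
by field; rewrite ?nat1r ?natr1 pnatr_eq0.
Qed.

Lemma sum_delta0 (A : pzRingType) m (F : nat -> A) : (0 < m)%N ->
  \sum_(0 <= k < m) (k == 0)%:R * F k = F 0%N.
Proof.
move=> m0; rewrite big_ltn // eqxx mul1r big_nat big1 ?addr0 // => k /andP[k0 _].
by rewrite gtn_eqF // mul0r.
Qed.

Theorem theorem3p1 (R : {set 'I_4 * 'I_4})
    (hR : R \in [:: A17; A18; A19; A20; A21; A22; A23; A24]) :
  let q1 : mesh_pattern 3 := (perm123, R) in
  let q2 : mesh_pattern 3 := (perm321, R) in
  let T (n k l : nat) : nat := joint_count q1 q2 n k l in
  [/\ jointly_equidistributed q1 q2,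
      forall n : nat, (2 <= n)%N ->
        [/\ forall k l : nat, (1 <= k)%N -> (1 <= l)%N ->
              T n k l = ('C(k + l + 2, k + 1)
                         * stirling1 (n - 1) (k + l + 2))%N,
            forall k : nat, (1 <= k)%N ->
              T n k 0%N = ((k + 2) * stirling1 (n - 1) (k + 2)
                         + stirling1 (n - 1) (k + 1))%N,
            forall l : nat, (1 <= l)%N ->
              T n 0%N l = ((l + 2) * stirling1 (n - 1) (l + 2)
                         + stirling1 (n - 1) (l + 1))%N
          & (T n 0%N 0%N)%:R = 2 * ((n - 2)`!)%:R
              * (1 + \sum_(1 <= i < n - 1) i%:R^-1) :> rat]
    & forall n : nat, (2 <= n)%N ->
        let x : {poly {poly int}} := 'X%:P in
        let y : {poly {poly int}} := 'X in
        \sum_(0 <= k < n - 1) \sum_(0 <= l < n - 1)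
            (T n k l)%:R * x ^+ k * y ^+ l
        = \sum_(0 <= i < n - 1)
            (stirling1 (n - 1) (i + 1))%:R * (x ^+ i + y ^+ i)
          + \sum_(0 <= k < n - 1) \sum_(0 <= l < n - 1)
              ('C(k + l + 2, k + 1) * stirling1 (n - 1) (k + l + 2))%:R
              * x ^+ k * y ^+ l].
Proof.
move=> q1 q2 T.
have TE m k l : T m.+1 k l = joint_mono A19 m.+1 k l by exact: joint_mono_eq.
split=> [[|m] k l // _|[|[|m]] // _|[|[|m]] // _ x y].
- by rewrite [LHS]TE [RHS]TE joint_monoC_A19.
- rewrite !subSS !subn0; split=> [[|k] [|l] // _ _|[|k] // _|[|l] // _|].
  + by rewrite TE joint_mono_A19 !addn0.
  + rewrite TE joint_mono_A19 !addn0 addn1 addn2 binSn; lia.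
  + rewrite TE joint_mono_A19 !addn0 add0n bin1; lia.
  (* Both single-indicator terms contribute c(n-1,1) = (n-2)!, and c(n-1,0) = 0 as n is at least
     2. *)
  + have -> : T m.+2 0%N 0%N = (2 * stirling1 m.+1 2 + 2 * m`!)%N.
      rewrite TE joint_mono_A19 -[(0 + 0 + 2)%N]/2%N -[(0 + 1)%N]/1%N eqxx bin1.
      by rewrite stirling1S1 -[stirling1 m.+1 0]/0%N; lia.
    by rewrite natrD !natrM stirling1S2; ring.
rewrite !subSS !subn0.
(* The single sum is spread over the square: powers of [y] along [k = 0], powers of [x] along
   [l = 0]. The origin is hit twice, matching [x ^+ 0 + y ^+ 0]. *)
have -> : \sum_(0 <= i < m.+1) (stirling1 m.+1 (i + 1))%:R * (x ^+ i + y ^+ i)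
  = \sum_(0 <= k < m.+1) \sum_(0 <= l < m.+1)
     (((k == 0%N) * stirling1 m.+1 (l + 1) + (l == 0%N) * stirling1 m.+1 (k + 1))%:R
       * x ^+ k * y ^+ l).
  under [RHS]eq_bigr => k _ do
    under eq_bigr => l _ do rewrite natrD !natrM 2!mulrDl -2!mulrA
      -[_ * _ * _ * _ ^+ l]mulrA -[_ * _ * (_ * _)]mulrA.
  under [RHS]eq_bigr => k _ do rewrite big_split /= -big_distrr /= sum_delta0 //.
  rewrite big_split /= sum_delta0 // -big_split /=; apply: eq_bigr => i _.
  by rewrite !expr0 mul1r mulr1 mulrDr addrC.
rewrite -big_split /=; apply: eq_bigr => k _.
rewrite -big_split /=; apply: eq_bigr => l _.
(* The fourth term vanishes, since [stirling1 m.+1 0] is 0. *)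
by rewrite TE joint_mono_A19 muln0 addn0 -addnA natrD !mulrDl addrC.
Qed.
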